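(* Let $k\geq 2$ be an integer and let $\lambda_{1},\ldots,\lambda_{k},w$ be real numbers satisfying $1\leq w\leq\min_{1\leq j\leq k}\lambda_{j}$. Then there exist uncountably many vectors $(\zeta_{1},\ldots,\zeta_{k})\in\mathbb{R}^{k}$ such that $1,\zeta_{1},\ldots,\zeta_{k}$ are linearly independent over $\mathbb{Q}$, $\lambda_{1}(\zeta_{j})=\lambda_{j}$ for $1\leq j\leq k$, and $\chi_{k}(\zeta_{1},\ldots,\zeta_{k})=w$.
   Context: $\Vert t\Vert$ denotes the distance of $t\in\mathbb{R}$ to the nearest integer. For $\zeta\in\mathbb{R}$, $\lambda_{1}(\zeta)$ is the supremum of real $\mu$ such that $\Vert x\zeta\Vert\leq x^{-\mu}$ has arbitrarily large integer solutions $x$. For $\underline{\zeta}=(\zeta_{1},\ldots,\zeta_{k})\in\mathbb{R}^{k}$, $\chi_{k}(\underline{\zeta})$ is the supremum of $\nu>0$ such that the system \[ 0<\min_{1\leq j\leq k}\vert x_{j}\vert\leq\max_{1\leq j\leq k}\vert x_{j}\vert\leq X,\qquad \max_{1\leq j\leq k}\Vert x_{j}\zeta_{j}\Vert\leq X^{-\nu} \] has a solution $(x_{1},\ldots,x_{k})\in\mathbb{Z}^{k}$ for arbitrarily large $X$. *)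

(* Defs.v *)
From HB Require Import structures.
From mathcomp Require Import all_boot all_order all_algebra.
From mathcomp Require Import all_classical all_reals all_analysis.

Set Implicit Arguments.
Unset Strict Implicit.
Unset Printing Implicit Defensive.

Import Order.TTheory GRing.Theory Num.Theory.

Local Open Scope classical_set_scope.
Local Open Scope ring_scope.

Definition dist_int (R : realType) (t : R) : R :=
  inf (range (fun n : int => `|t - n%:~R|)).

(* Both exponents below are suprema in the extended reals, so that an unbounded
   set of admissible exponents has supremum +oo rather than a junk real value.
   [powR] is total; only its values at large, hence positive, bases matter,
   as the lower bounds [N] and [B] are arbitrary. *)

Definition lambda1 (R : realType) (zeta : R) : \bar R :=
  ereal_sup [set mu%:E | mu in [set mu : R |
    forall N : int, exists2 x : int, N <= x &
      dist_int (x%:~R * zeta) <= x%:~R `^ (- mu)]].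

Definition chi (R : realType) (k : nat) (zeta : 'rV[R]_k) : \bar R :=
  ereal_sup [set nu%:E | nu in [set nu : R | 0 < nu /\
    forall B : R, exists2 X : R, B <= X &
      exists x : 'I_k -> int,
        [/\ forall j, 0 < `|x j|,
            forall j, `|x j|%:~R <= X &
            forall j, dist_int ((x j)%:~R * zeta ord0 j) <= X `^ (- nu)]]].

Definition Q_lin_indep (R : realType) (n : nat) (v : 'rV[R]_n) : Prop :=
  forall q : 'I_n -> rat,
    \sum_(i < n) ratr (q i) * v ord0 i = 0 -> forall i, q i = 0.

(* Main.v *)
(* If q_0 <= q_1 <= ... are the denominators of the convergents of zeta, then for
   q_n <= X < q_{n+1} the minimum of ||x zeta|| over 0 < |x| <= X is ||q_n zeta||,
   which is 1 / q_{n+1} up to a factor 2. Hence lambda_1 and chi only depend on the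
   gaps in the sequences of denominators. Fix rapidly growing stages T_i and build
   continued fractions with q_{n+1} of order q_n outside the stages, and of order
   q_n^c when q_n lies in [T_i, 4 T_i). Cyclically in i, either only zeta_j has a
   gap, with c = lambda_j, or all zeta_j have one, with c = w. At a scale X outside
   the common gaps at most one coordinate is in a gap, so k >= 2 leaves another
   coordinate of exponent 1 <= w. Each partial quotient may still be increased by
   0 or 1, so every zeta_j ranges over an uncountable set, and it can be chosen
   outside the countable Q-span of 1 and the previous coordinates. *)

Require Import Defs.
From HB Require Import structures.
From mathcomp Require Import all_boot all_order all_algebra.
From mathcomp Require Import all_classical all_reals all_analysis.
From mathcomp Require Import ring lra zify.

Set Implicit Arguments.
Unset Strict Implicit.
Unset Printing Implicit Defensive.

Import Order.TTheory GRing.Theory Num.Theory.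

Local Open Scope classical_set_scope.
Local Open Scope ring_scope.

(** * Continued fractions, convergents and signed errors *)

Section ContinuedFractions.

Implicit Types (a : nat -> nat) (s : nat * nat).

Fixpoint cfstate a s (n : nat) : nat * nat :=
  if n is m.+1 then
    let: (x, y) := cfstate a s m in (y, ((a m).+1 * y + x)%N)
  else s.

(* The [n]-th partial quotient is [(a n).+1], which makes every [a] admissible;
   indices are shifted by one, so that cfden a 0 = 0 and cfden a 1 = 1. *)
Definition cfden a n := (cfstate a (0, 1)%N n).1.
Definition cfnum a n := (cfstate a (1, 0)%N n).1.

Lemma cfstateSS a s n : (cfstate a s n.+2).1 =
  ((a n).+1 * (cfstate a s n.+1).1 + (cfstate a s n).1)%N.
Proof. by rewrite /=; case: (cfstate a s n). Qed.

Lemma eq_cfstate a a' s n :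
  (forall m, (m < n)%N -> a m = a' m) -> cfstate a s n = cfstate a' s n.
Proof.
elim: n => //= n IH aa'; rewrite IH => [|m mn]; last by rewrite aa'// ltnW.
by rewrite aa'.
Qed.

Lemma cfdenSS a n : cfden a n.+2 = ((a n).+1 * cfden a n.+1 + cfden a n)%N.
Proof. exact: cfstateSS. Qed.

Lemma cfnumSS a n : cfnum a n.+2 = ((a n).+1 * cfnum a n.+1 + cfnum a n)%N.
Proof. exact: cfstateSS. Qed.

Lemma cfden_gt0 a n : (0 < cfden a n.+1)%N.
Proof. by elim: n => // n IH; rewrite cfdenSS addn_gt0 muln_gt0 IH. Qed.

Lemma cfden_leS a n : (cfden a n <= cfden a n.+1)%N.
Proof. by case: n => // n; rewrite cfdenSS; nia. Qed.

Lemma cfden_ge a n : (n <= cfden a n.+1)%N.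
Proof.
elim: n => // -[_|n IH]; first by rewrite cfdenSS.
by rewrite cfdenSS; have := cfden_gt0 a n; nia.
Qed.

Variable R : realType.
Implicit Types z : R.

(** The sign makes this |q_n z - p_n| when z is the value of the continued fraction; index 0 is the
    formal convergent 1/0. *)
Definition cferr a z n : R := (-1) ^+ n * ((cfnum a n)%:R - (cfden a n)%:R * z).

Lemma cferrSS a z n : cferr a z n.+2 = cferr a z n - (a n).+1%:R * cferr a z n.+1.
Proof.
by rewrite /cferr cfdenSS cfnumSS !natrD !natrM !exprS; ring.
Qed.

Lemma cferr_det a z n :
  (cfden a n.+1)%:R * cferr a z n + (cfden a n)%:R * cferr a z n.+1 = 1.
Proof.
elim: n => [|n IH].
  by rewrite /cferr /= !mul0r subr0 addr0 expr0 !mulr1.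
by rewrite cferrSS cfdenSS -[RHS]IH natrD natrM; ring.
Qed.

Definition cfconv a n : R := (cfnum a n)%:R / (cfden a n)%:R.

Lemma cfconvE a n : (cfnum a n.+1)%:R = (cfden a n.+1)%:R * cfconv a n.+1.
Proof. by rewrite mulrC divfK// pnatr_eq0 -lt0n cfden_gt0. Qed.

(** The error vanishes at index N+1 and is positive at index N; the recurrence read downwards only
    adds nonnegative terms. *)
Lemma cferr_conv_ge0 a N n : (n <= N.+1)%N -> 0 <= cferr a (cfconv a N.+1) n.
Proof.
set z := cfconv _ _ => nN.
have q0 : (0 : R) < (cfden a N.+1)%:R by rewrite ltr0n cfden_gt0.
have e0 : cferr a z N.+1 = 0.
  by rewrite /cferr cfconvE subrr mulr0.
have e1 : 0 <= cferr a z N.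
  have := cferr_det a z N; rewrite e0 mulr0 addr0 => h.
  by rewrite -(pmulr_rge0 _ q0) h.
have H d : (d <= N)%N -> 0 <= cferr a z (N - d) /\ 0 <= cferr a z (N - d).+1.
  elim: d => [|d IH] dN; first by rewrite subn0 e0.
  have [i0 i1] := IH (ltnW dN).
  have E : (N - d = (N - d.+1).+1)%N by lia.
  rewrite E in i0 i1; split => //.
  by move: i1; rewrite cferrSS subr_ge0; apply: le_trans; rewrite mulr_ge0.
move: nN; rewrite leq_eqVlt => /predU1P[->|]; first by rewrite e0.
by rewrite ltnS => nN; have [] := H (N - n)%N (leq_subr _ _); rewrite subKn.
Qed.

Lemma cferr_odd a z n : odd n ->
  cferr a z n = (cfden a n)%:R * (z - cfconv a n).
Proof.
case: n => // n on; rewrite /cferr cfconvE -signr_odd on expr1.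
by ring.
Qed.

Lemma cferr_even a z n : ~~ odd n.+1 ->
  cferr a z n.+1 = (cfden a n.+1)%:R * (cfconv a n.+1 - z).
Proof.
move=> on; rewrite /cferr cfconvE -signr_odd (negbTE on) expr0.
by ring.
Qed.

(** Convergents of odd index lie below those of positive even index, so a supremum replaces a limit.
    Even index 0 is left out: there 1/0 evaluates to 0. *)
Definition cfval a : R := sup [set cfconv a n | n in [set n | odd n]].

Lemma cfconv_odd_even a m n : odd m -> ~~ odd n.+1 ->
  cfconv a m <= cfconv a n.+1.
Proof.
case: m => // m om en.
have qm : (0 : R) < (cfden a m.+1)%:R by rewrite ltr0n cfden_gt0.
have qn : (0 : R) < (cfden a n.+1)%:R by rewrite ltr0n cfden_gt0.
have [mn|/ltnW nm] := leqP m.+1 n.+1.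
  have := cferr_conv_ge0 a mn.
  by rewrite cferr_odd// pmulr_rge0// subr_ge0.
have := cferr_conv_ge0 a nm.
by rewrite cferr_even// pmulr_rge0// subr_ge0.
Qed.

Lemma cferr_ge0 a n : 0 <= cferr a (cfval a) n.
Proof.
have [on|en] := boolP (odd n).
  rewrite cferr_odd// mulr_ge0// subr_ge0; apply: ub_le_sup; last by exists n.
  by exists (cfconv a 2) => _ [m om <-]; exact: cfconv_odd_even.
case: n en => [_|n en]; first by rewrite /cferr /= mul0r subr0 expr0 mulr1.
rewrite cferr_even// mulr_ge0// subr_ge0; apply: ge_sup.
  by exists (cfconv a 1), 1%N.
by move=> _ [m om <-]; exact: cfconv_odd_even.
Qed.

Lemma cferrS_le a n : cferr a (cfval a) n.+1 <= cferr a (cfval a) n.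
Proof.
have := cferr_ge0 a n.+2; rewrite cferrSS subr_ge0; apply: le_trans.
by rewrite ler_peMl ?cferr_ge0// ler1n.
Qed.

Lemma cferr_le a n : cferr a (cfval a) n <= (cfden a n.+1)%:R^-1.
Proof.
have q0 : (0 : R) < (cfden a n.+1)%:R by rewrite ltr0n cfden_gt0.
rewrite -[leRHS]mulr1 ler_pdivlMl// -[leRHS](cferr_det a (cfval a) n).
by rewrite lerDl mulr_ge0// cferr_ge0.
Qed.

(** In the identity of [cferr_det] the second term is at most the first, so the first is at least
    1/2. *)
Lemma cferr_ge a n : (2 * (cfden a n.+1)%:R)^-1 <= cferr a (cfval a) n.
Proof.
have q0 : (0 : R) < (cfden a n.+1)%:R by rewrite ltr0n cfden_gt0.
rewrite -[leLHS]mulr1 ler_pdivrMl ?mulr_gt0// -[leLHS](cferr_det a (cfval a) n).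
have := cferrS_le a n; have := cferr_ge0 a n.+1.
have : (cfden a n)%:R <= (cfden a n.+1)%:R :> R by rewrite ler_nat cfden_leS.
nra.
Qed.

Lemma cferr_gt0 a n : 0 < cferr a (cfval a) n.
Proof.
apply: lt_le_trans (cferr_ge a n).
by rewrite invr_gt0 mulr_gt0// ltr0n cfden_gt0.
Qed.

Lemma cferrS_lt a n : cferr a (cfval a) n.+1 < cferr a (cfval a) n.
Proof.
have := cferr_gt0 a n.+2; rewrite cferrSS subr_gt0; apply: le_lt_trans.
by rewrite ler_peMl ?cferr_ge0// ler1n.
Qed.

(** Writing e_n for the errors, 0 <= e_n - (a n + 1) e_{n+1} < e_{n+1}: a Euclidean division
    recovers [a n] from errors fixed by the value and the earlier quotients. *)
Lemma cfval_inj a a' : cfval a = cfval a' -> a =1 a'.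
Proof.
move=> zz n; elim/ltn_ind: n => n IH.
have e m : (m <= n.+1)%N -> cferr a (cfval a) m = cferr a' (cfval a') m.
  case: m => [|m] mn; first by rewrite /cferr /= !mul0r.
  rewrite -zz /cferr /cfnum /cfden.
  have E s : (cfstate a s m.+1).1 = (cfstate a' s m.+1).1.
    rewrite /= (@eq_cfstate a a')//.
      by case: (cfstate a' s m).
    by move=> i im; apply: IH; rewrite (leq_trans im).
  by rewrite !E.
have := cferr_ge0 a n.+2; have := cferr_ge0 a' n.+2.
have := cferrS_lt a n.+1; have := cferrS_lt a' n.+1.
rewrite !cferrSS !e//; set x := cferr _ _ n; set y := cferr _ _ n.+1.
have y0 : 0 < y by exact: cferr_gt0.
move=> h1 h2 h3 h4.
have le m m' : x - m.+1%:R * y < y -> 0 <= x - m'.+1%:R * y -> (m' <= m)%N.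
  move=> hm hm'; rewrite -ltnS -[(_ < _)%N](ltr_nat R) -(ltr_pM2r y0).
  by move: hm hm'; rewrite -![_.+1%:R]natr1; lra.
by apply/eqP; rewrite eqn_leq !le.
Qed.

(** * Distance to the nearest integer and best approximation *)

Lemma dist_int_le (t : R) (n : int) : dist_int t <= `|t - n%:~R|.
Proof. by apply: ge_inf; [exists 0 => _ [m _ <-] | exists n]. Qed.

Lemma le_dist_int (c t : R) :
  (forall n : int, c <= `|t - n%:~R|) -> c <= dist_int t.
Proof.
move=> h; apply: lb_le_inf; first by exists `|t - 0%:~R|, 0.
by move=> _ [n _ <-].
Qed.

Lemma dist_int_cfden a n :
  dist_int ((cfden a n)%:R * cfval a) <= (cfden a n.+1)%:R^-1.
Proof.
apply: le_trans (cferr_le a n).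
rewrite -[leRHS]ger0_norm ?cferr_ge0// /cferr normrMsign distrC.
by have := dist_int_le ((cfden a n)%:R * cfval a) (cfnum a n).
Qed.

Lemma best_approximation a n (x : int) : x != 0 -> `|x| < (cfden a n.+1)%:Z ->
  cferr a (cfval a) n <= dist_int (x%:~R * cfval a).
Proof.
move=> x0 xq; apply: le_dist_int => y.
(* (x, y) = u (q_n, p_n) + v (q_{n+1}, p_{n+1}) with u v <= 0, while the two
     signed errors alternate, so the two contributions add up in absolute value. *)
set e : int := (-1) ^+ n.
have det : (cfden a n.+1)%:Z * (cfnum a n)%:Z - (cfden a n)%:Z * (cfnum a n.+1)%:Z = e.
  rewrite /e; elim: n {xq e} => [|n IH] //.
  by rewrite cfdenSS cfnumSS exprS -IH !PoszD !PoszM; ring.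
have ee : e * e = 1 by rewrite /e -expr2 sqrr_sign.
pose u := e * (y * (cfden a n.+1)%:Z - x * (cfnum a n.+1)%:Z).
pose v := e * (x * (cfnum a n)%:Z - y * (cfden a n)%:Z).
have Ex : x = u * (cfden a n)%:Z + v * (cfden a n.+1)%:Z.
  by rewrite -[LHS]mul1r -ee -{2}det /u /v; ring.
have Ey : y = u * (cfnum a n)%:Z + v * (cfnum a n.+1)%:Z.
  by rewrite -[LHS]mul1r -ee -{2}det /u /v; ring.
(* Here |x| < q_{n+1} enters: u = 0 would make x a nonzero multiple of q_{n+1}, and u, v of equal
   sign would give |x| >= q_{n+1}. *)
have u0 : u != 0.
  apply: contraTneq xq => u0; move: x0; rewrite Ex u0 mul0r add0r => x0.
  rewrite -leNgt normrM; apply: ler_peMl => //.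
  by rewrite -gtz0_ge1 normr_gt0; apply: contraNneq x0 => ->; rewrite mul0r.
have uv : u * v <= 0.
  rewrite leNgt; apply/negP => uv; move: xq; rewrite Ex ltr_norml => /andP[].
  have le (s t b c : int) : 0 < s -> 0 < t -> 0 <= b -> 0 <= c -> c <= s * b + t * c.
    move=> s0 t0 b0 c0; rewrite -[leLHS]add0r; apply: lerD.
      by rewrite mulr_ge0// ltW.
    by apply: ler_peMl; rewrite // -gtz0_ge1.
  have [u_lt0|u_gt0|/eqP] := ltgtP u 0; last by rewrite (negbTE u0).
    have v_lt0 : 0 < - v by move: uv; rewrite nmulr_rgt0// oppr_gt0.
    have u'_gt0 : 0 < - u by rewrite oppr_gt0.
    by have := le _ _ (cfden a n)%:Z (cfden a n.+1)%:Z u'_gt0 v_lt0 isT isT; lia.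
  have v_gt0 : 0 < v by move: uv; rewrite pmulr_rgt0.
  by have := le _ _ (cfden a n)%:Z (cfden a n.+1)%:Z u_gt0 v_gt0 isT isT; lia.
have -> : `|x%:~R * cfval a - y%:~R| =
    `|u%:~R * cferr a (cfval a) n - v%:~R * cferr a (cfval a) n.+1|.
  rewrite -[RHS](normrMsign n.+1) Ex Ey /cferr !intrD !intrM; congr `|_|.
  have e2 : (-1) ^+ n * (-1) ^+ n = 1 :> R by rewrite -expr2 sqrr_sign.
  rewrite exprS; set s := (-1) ^+ n in e2 *.
  by ring: e2.
have e0 := cferr_ge0 a n; have e1 := cferr_ge0 a n.+1.
have [u_lt0|u_gt0|/eqP] := ltgtP u 0; last by rewrite (negbTE u0).
- have v0 : (0 : R) <= v%:~R by move: uv; rewrite nmulr_rle0// ler0z.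
  have u1 : u%:~R <= -1 :> R by rewrite -[-1]/((-1)%:~R) ler_int; lia.
  rewrite -normrN; apply: le_trans (ler_norm _).
  have : 0 <= (-1 - u%:~R) * cferr a (cfval a) n by rewrite mulr_ge0// subr_ge0.
  have : 0 <= v%:~R * cferr a (cfval a) n.+1 by rewrite mulr_ge0.
  by lra.
- have v0 : v%:~R <= 0 :> R by move: uv; rewrite pmulr_rle0// lerz0.
  have u1 : 1 <= u%:~R :> R by rewrite ler1z; lia.
  apply: le_trans (ler_norm _).
  have : 0 <= (u%:~R - 1) * cferr a (cfval a) n by rewrite mulr_ge0// subr_ge0.
  have : 0 <= - v%:~R * cferr a (cfval a) n.+1 by rewrite mulr_ge0// oppr_ge0.
  by lra.
Qed.

End ContinuedFractions.

(** * Continued fractions with prescribed growth of denominators *)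

Section PrescribedGrowth.

Variables (R : realType) (phi : nat -> R).
Hypothesis phi_ge1 : forall Q, 1 <= phi Q.

(* Denominators Q are followed by one of order Q^(phi Q): the first part bounds
   ||x z|| from below at every scale X, the second finds a denominator in
   [T, 4 T) whenever no gap of phi reaches across T. *)
Definition controlled_by z :=
  (forall X : R, 1 <= X -> exists Q : nat,
    [/\ 1 <= Q%:R :> R, Q%:R <= X, X < 4 * Q%:R `^ phi Q &
        forall x : int, x != 0 -> `|x|%:~R <= X ->
          (8 * Q%:R `^ phi Q)^-1 <= dist_int (x%:~R * z)]) /\
  (forall T : R, 1 < T ->
    (forall Q : nat, 1 <= Q%:R :> R -> Q%:R < T -> Q%:R `^ phi Q < T) ->
    exists Q : nat,
      [/\ T <= Q%:R, Q%:R < 4 * T & dist_int (Q%:R * z) <= Q%:R `^ (- phi Q)]).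

(** Each quotient depends on a denominator built from earlier quotients, so the denominators are
    generated first and the quotients read off afterwards. *)
Fixpoint adaptive_state (g : nat -> nat -> nat) n : nat * nat :=
  if n is m.+1 then
    let: (x, y) := adaptive_state g m in (y, ((g m y).+1 * y + x)%N)
  else (0, 1)%N.

Lemma adaptive_quotients (g : nat -> nat -> nat) :
  exists a, forall n, a n = g n (cfden a n.+1).
Proof.
pose a n := g n (adaptive_state g n).2.
exists a => n.
have E m : cfstate a (0, 1)%N m = adaptive_state g m.
  elim: m => //= m ->; rewrite /a.
  by case: (adaptive_state g m).
by rewrite /cfden /= E /a; case: (adaptive_state g n).
Qed.

(* The free term [b n] does not affect the order of growth; it makes the number
   of admissible expansions uncountable. *)
Definition quotient_rule (b : nat -> bool) n (Q : nat) : nat :=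
  (Num.truncn (Q%:R `^ (phi Q - 1)) + b n)%N.

Section Growth.

Variables (b : nat -> bool) (a : nat -> nat).
Hypothesis aE : forall n, a n = quotient_rule b n (cfden a n.+1).

Lemma cfden_growth n :
  (cfden a n.+1)%:R `^ phi (cfden a n.+1) <= (cfden a n.+2)%:R :> R /\
  (cfden a n.+2)%:R <= 4 * (cfden a n.+1)%:R `^ phi (cfden a n.+1).
Proof.
rewrite cfdenSS aE /quotient_rule.
have q0 := cfden_gt0 a n; have qq := cfden_leS a n.
set Q := cfden a n.+1 in q0 qq *; set q := cfden a n in qq *.
have Q0 : (0 : R) < Q%:R by rewrite ltr0n.
have -> : Q%:R `^ phi Q = Q%:R `^ (phi Q - 1) * Q%:R.
  rewrite -[X in _ = _ * X](powRr1 (ltW Q0)) -powRD ?subrK//.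
  by apply/implyP => _; rewrite gt_eqF.
(* The quotient t + b + 1 lies between P and P + 2, and the previous denominator adds at most Q; P +
   3 <= 4 P gives the constant 4. *)
set P := Q%:R `^ (phi Q - 1).
have P1 : 1 <= P.
  rewrite -(powRr0 Q%:R); apply: ler_powR; last by rewrite subr_ge0.
  by rewrite ler1n.
have /andP[t1 t2] := truncn_itv (le_trans ler01 P1).
set t := Num.truncn P in t1 t2 *.
have {}qq : q%:R <= Q%:R :> R by rewrite ler_nat.
have q_ge0 : 0 <= q%:R :> R by [].
have b0 : 0 <= (b n)%:R :> R by [].
have b1 : (b n)%:R <= 1 :> R by case: (b n).
move: t2; rewrite natrD natrM -!natr1 natrD => t2.
split.
  have : 0 <= (t%:R + 1 - P + (b n)%:R) * Q%:R by rewrite mulr_ge0//; lra.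
  by lra.
have : 0 <= (P - t%:R + (1 - (b n)%:R)) * Q%:R by rewrite mulr_ge0//; lra.
have : 0 <= (P - 1) * Q%:R by rewrite mulr_ge0//; lra.
by lra.
Qed.

Lemma cfden_bracket (X : R) : 1 <= X ->
  exists n, (cfden a n.+1)%:R <= X /\ X < (cfden a n.+2)%:R.
Proof.
move=> X1.
have ex : exists n, X < (cfden a n.+1)%:R.
  exists (Num.truncn X).+1; apply: lt_le_trans (truncnS_gt X) _.
  by rewrite ler_nat cfden_ge.
case: (ex_minnP ex) => -[|n Xn min]; first by rewrite ltNge X1.
by exists n; split => //; rewrite leNgt; apply/negP => /min; rewrite ltnn.
Qed.

Lemma cfden_crossing (T : R) : 1 < T ->
  exists n, (cfden a n.+1)%:R < T /\ T <= (cfden a n.+2)%:R.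
Proof.
move=> T1.
have ex : exists n, T <= (cfden a n.+1)%:R.
  exists (Num.truncn T).+1; apply: ltW; apply: lt_le_trans (truncnS_gt T) _.
  by rewrite ler_nat cfden_ge.
case: (ex_minnP ex) => -[|n Tn min]; first by rewrite leNgt T1.
by exists n; split => //; rewrite ltNge; apply/negP => /min; rewrite ltnn.
Qed.

Lemma controlled_cfval : controlled_by (cfval R a).
Proof.
split=> [X X1|T T1 below].
  have [n [nX Xn]] := cfden_bracket X1; exists (cfden a n.+1).
  have [_ up] := cfden_growth n; split => //.
  - by rewrite ler1n cfden_gt0.
  - exact: lt_le_trans up.
  (* The 8 combines the 2 of [cferr_ge] with the 4 of [cfden_growth]. *)
  move=> x x0 xX; apply: le_trans (best_approximation R x0 _).
    apply: le_trans (cferr_ge R a n.+1).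
    rewrite lef_pV2 ?posrE ?mulr_gt0 ?powR_gt0 ?ltr0n ?cfden_gt0//.
    by lra.
  by rewrite -(ltr_int R) (le_lt_trans xX).
(* The last denominator below T has its power still below T, so its successor, which is at least T,
   stays below 4 T. *)
have [n [nT Tn]] := cfden_crossing T1.
have q1 : 1 <= (cfden a n.+1)%:R :> R by rewrite ler1n cfden_gt0.
exists (cfden a n.+2); split => //.
  have [_ up] := cfden_growth n; apply: le_lt_trans up _.
  by rewrite ltr_pM2l// below.
apply: le_trans (dist_int_cfden R a n.+2) _.
rewrite powRN lef_pV2 ?posrE ?powR_gt0 ?ltr0n ?cfden_gt0//.
by have [] := cfden_growth n.+1.
Qed.

End Growth.

(** Equal values force equal quotients, hence equal denominators and equal integer parts; cancelling
    these leaves equal free terms. *)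
Lemma exists_controlled : exists z : (nat -> bool) -> R,
  injective z /\ forall b, controlled_by (z b).
Proof.
have [a aE] := choice (fun b => adaptive_quotients (quotient_rule b)).
exists (fun b => cfval R (a b)); split; last first.
  by move=> b; exact: controlled_cfval (aE b).
move=> b b' /cfval_inj /funext aa; apply/funext => n.
have := aE b n; rewrite aa aE /quotient_rule => /addnI.
by case: (b n) (b' n) => -[].
Qed.

End PrescribedGrowth.

(** * Bounds for the two exponents *)

Section Eventually.
Variable R : realType.
Implicit Types z C d : R.

Lemma powR_eventually_gt C d : 0 < d ->
  exists2 N : R, 1 <= N & forall X, N <= X -> C < X `^ d.
Proof.
move=> d0; set M := Num.max 1 (C + 1).
have M1 : 1 <= M by rewrite le_max lexx.
have CM : C < M by rewrite lt_max [C < C + 1]ltrDl ltr01 orbT.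
have N1 : 1 <= M `^ d^-1.
  by rewrite -(powRr0 M) ler_powR// invr_ge0 ltW.
exists (M `^ d^-1) => // X NX.
have M0 := le_trans ler01 M1.
apply: lt_le_trans CM _; rewrite -[leLHS](powRr1 M0).
rewrite -(mulVf (lt0r_neq0 d0)) powRrM ge0_ler_powR ?nnegrE ?powR_ge0// ?ltW//.
by rewrite (lt_le_trans ltr01)// (le_trans N1).
Qed.

(** Absorbs the constants 8 and 4^nu, which therefore do not affect the suprema. *)
Lemma powR_separated C mu nu : 0 < C -> nu < mu ->
  exists2 N : R, 1 <= N & forall X, N <= X -> X `^ (- mu) < (C * X `^ nu)^-1.
Proof.
move=> C0 numu; have [|N N1 NX] := @powR_eventually_gt C (mu - nu).
  by rewrite subr_gt0.
exists N => // X /[dup] XN /NX; have X0 : 0 < X by lra.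
rewrite powRN ltf_pV2 ?posrE ?mulr_gt0 ?powR_gt0//.
rewrite -(ltr_pM2r (powR_gt0 nu X0)) -powRD ?subrK//.
by apply/implyP => _; rewrite gt_eqF.
Qed.

Lemma lambda1_le z (lam : R) :
  (forall x : int, 1 <= x -> (8 * x%:~R `^ lam)^-1 <= dist_int (x%:~R * z)) ->
  (lambda1 z <= lam%:E)%E.
Proof.
move=> h; apply: ge_ereal_sup => _ [mu /= hmu <-]; rewrite lee_fin leNgt.
apply/negP => lammu; have [//|N N1 NX] := @powR_separated 8 _ _ _ lammu.
have [x Nx] := hmu (Num.ceil N); apply/negP; rewrite -ltNge.
have xN : N <= x%:~R by rewrite (le_trans (ceil_ge N))// ler_int.
apply: lt_le_trans (NX _ xN) (h _ _).
by rewrite -(ler1z R) (le_trans N1).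
Qed.

Lemma lambda1_ge z (lam : R) :
  (forall B : R, exists2 Q : nat, B <= Q%:R &
    dist_int (Q%:R * z) <= Q%:R `^ (- lam)) ->
  (lam%:E <= lambda1 z)%E.
Proof.
move=> h; apply: ereal_sup_ubound; exists lam => // N.
have [Q NQ hQ] := h N%:~R; exists Q => //.
by rewrite -(ler_int R).
Qed.

(** The maximum over the coordinates dominates each of them, so the badly approximable [j] may vary
    with [X]. *)
Lemma chi_le k (zeta : 'rV[R]_k) (w : R) :
  (forall X : R, 1 <= X -> exists j, forall x : int, x != 0 -> `|x|%:~R <= X ->
     (8 * X `^ w)^-1 <= dist_int (x%:~R * zeta ord0 j)) ->
  (chi zeta <= w%:E)%E.
Proof.
move=> h; apply: ge_ereal_sup => _ [nu /= [_ hnu] <-]; rewrite lee_fin leNgt.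
apply/negP => wnu; have [//|N N1 NX] := @powR_separated 8 _ _ _ wnu.
have [X XN [x [x0 xX hx]]] := hnu N.
have [j hj] := h X (le_trans N1 XN).
have := hj (x j); rewrite -normr_gt0 => /(_ (x0 j) (xX j)).
by apply/negP; rewrite -ltNge (le_lt_trans (hx j))// NX.
Qed.

Lemma chi_ge k (zeta : 'rV[R]_k) (w : R) : 1 <= w ->
  (forall B : R, exists2 T : R, B <= T & forall j, exists Q : nat,
    [/\ T <= Q%:R, Q%:R < 4 * T &
        dist_int (Q%:R * zeta ord0 j) <= Q%:R `^ (- w)]) ->
  (w%:E <= chi zeta)%E.
Proof.
move=> w1 h; have w0 := lt_le_trans ltr01 w1.
apply/lee_addgt0Pr => e e0.
(* The term w / 2 keeps nu positive, as [chi] demands, even when e exceeds w. *)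
pose nu := Num.max (w - e) (w / 2).
have nuw : nu < w by rewrite gt_max; lra.
have nu0 : 0 < nu by rewrite lt_max; apply/orP; right; lra.
have wnu : w <= nu + e by rewrite -lerBlDr le_max lexx.
apply: (@le_trans _ _ (nu + e)%:E); first by rewrite lee_fin.
rewrite EFinD leeD2r//; apply: ereal_sup_ubound; exists nu => //; split => // B.
have [//|N N1 NX] := @powR_separated (4 `^ nu) w nu _ nuw.
have [T NBT hT] := h (Num.max N B).
move: NBT; rewrite ge_max => /andP[NT BT].
have T1 : 1 <= T by exact: le_trans NT.
(* 4 T bounds all the Q_j at once; the factor 4^nu this costs is affordable because nu < w. *)
exists (4 * T); first lra.
have [Q HQ] := choice hT.
have Q0 j : 0 < (Q j)%:R :> R by have [? _ _] := HQ j; lra.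
exists (fun j => Q j); split=> j.
- by rewrite normr_gt0 eqz_nat -lt0n -(ltr0n R).
- by have [_ /ltW] := HQ j.
have [TQ QT hQ] := HQ j.
apply: le_trans hQ _; apply: (@le_trans _ _ (T `^ (- w))).
  have T0 := lt_le_trans ltr01 T1.
  rewrite !powRN lef_pV2 ?posrE ?powR_gt0//.
  by rewrite ge0_ler_powR ?nnegrE//; exact: ltW.
apply: ltW; apply: lt_le_trans (NX _ NT) _.
by rewrite powRN powRM//; lra.
Qed.

End Eventually.

(** * Sparse stages and the exponents assigned to them *)

Section Schedule.

Variables (R : realType) (Lam : R).
Hypothesis Lam_ge1 : 1 <= Lam.

(** A gap opened at Q < 4 T_i with exponent at most Lam ends by 4 Q^Lam, hence before the next stage
    begins. *)
Fixpoint stage (i : nat) : R :=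
  if i is j.+1 then 4 * (4 * stage j) `^ Lam else 2.

Lemma stageS i : stage i.+1 = 4 * (4 * stage i) `^ Lam.
Proof. by []. Qed.

Lemma le_powR_id (x c : R) : 1 <= x -> 1 <= c -> x <= x `^ c.
Proof.
by move=> x1 c1; rewrite -[leLHS]powRr1 ?ler_powR// (le_trans ler01).
Qed.

Lemma stage_gt i : i.+1%:R < stage i.
Proof.
elim: i => [|i IH]; first by rewrite ltr1n.
have i0 : 0 <= i%:R :> R by [].
rewrite stageS -natr1; move: IH; rewrite -natr1 => IH.
have /le_powR_id/(_ Lam_ge1) : 1 <= 4 * stage i by lra.
by lra.
Qed.

Lemma stage_gt1 i : 1 < stage i.
Proof. by apply: le_lt_trans (stage_gt i); rewrite ler1n. Qed.

Lemma stage_powR i (Q c : R) : 1 <= Q -> Q < 4 * stage i -> c <= Lam ->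
  4 * Q `^ c <= stage i.+1.
Proof.
move=> Q1 Qi cL; rewrite stageS ler_pM2l//; apply: le_trans (ler_powR Q1 cL) _.
have ? := stage_gt1 i.
have ? := Lam_ge1.
by rewrite ge0_ler_powR ?nnegrE//; lra.
Qed.

Lemma stage_incr i : 4 * stage i < stage i.+1.
Proof.
have ? := stage_gt1 i.
have /le_powR_id/(_ Lam_ge1) : 1 <= 4 * stage i by lra.
by rewrite stageS; lra.
Qed.

Lemma stage_le : {homo stage : i l / (i <= l)%N >-> i <= l}.
Proof.
apply: homo_leq => // [? ? ?|i]; first exact: le_trans.
by have := stage_incr i; have := stage_gt1 i; lra.
Qed.

Lemma stage_lt_lt i l (x : R) : stage i <= x -> x < stage l -> (i < l)%N.
Proof.
move=> ix xl; rewrite ltnNge; apply/negP => /stage_le; rewrite leNgt => /negP.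
by apply; exact: le_lt_trans xl.
Qed.

Lemma stage_uniq i l (x : R) : stage i <= x -> x < 4 * stage i ->
  stage l <= x -> x < 4 * stage l -> i = l.
Proof.
move=> i1 i2 l1 l2.
have := stage_lt_lt i1 (lt_trans l2 (stage_incr l)).
have := stage_lt_lt l1 (lt_trans i2 (stage_incr i)).
by rewrite !ltnS => li il; apply/eqP; rewrite eqn_leq li il.
Qed.

Definition follows (c : nat -> R) (phi : nat -> R) :=
  [/\ forall Q, 1 <= phi Q,
      forall i (Q : nat), stage i <= Q%:R -> Q%:R < 4 * stage i -> phi Q = c i &
      forall Q, phi Q = 1 \/
        exists i, [/\ stage i <= Q%:R, Q%:R < 4 * stage i & phi Q = c i]].

(** The windows [T_i, 4 T_i) are pairwise disjoint, so at most one [c i] applies to each [Q]. *)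
Lemma exists_follows (c : nat -> R) : (forall i, 1 <= c i) ->
  exists phi, follows c phi.
Proof.
move=> c1.
pose in_stage (Q i : nat) := stage i <= Q%:R /\ Q%:R < 4 * stage i.
have /choice[phi hphi] (Q : nat) : exists r : R,
    (forall i, in_stage Q i -> r = c i) /\
    (r = 1 \/ exists2 i, in_stage Q i & r = c i).
  have [[i Qi]|no] := pselect (exists i, in_stage Q i).
    exists (c i); split; last by right; exists i.
    move=> l Ql; congr c; case: Qi Ql => ? ? [? ?].
    by apply: (@stage_uniq _ _ Q%:R).
  by exists 1; split; [move=> i Qi; case: no; exists i | left].
exists phi; split => [Q|i Q i1 i2|Q].
- by have [_ [->|[i _ ->]]] := hphi Q.
- by have [+ _] := hphi Q; apply.
- by have [_ [->|[i [? ?] ?]]] := hphi Q; [left | right; exists i].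
Qed.

(** Supplies the premise of the second half of [controlled_by] at T = T_i: gaps of earlier stages
    have closed by then, and outside the stages the exponent is 1. *)
Lemma follows_below c phi i (Q : nat) : (forall i, c i <= Lam) ->
  follows c phi -> 1 <= Q%:R :> R -> Q%:R < stage i -> Q%:R `^ phi Q < stage i.
Proof.
move=> cL [_ _ /(_ Q)[->|[l [l1 l2 ->]]]] Q1 Qi.
  by rewrite powRr1// (le_trans ler01).
have := stage_powR Q1 l2 (cL l).
have := stage_le (stage_lt_lt l1 Qi).
have : 0 < Q%:R `^ c l by rewrite powR_gt0//; lra.
by lra.
Qed.

End Schedule.

(** * Linear independence over the rationals and uncountability *)

Section Independence.
Variable R : realType.

Lemma countableU (T : Type) (A B : set T) :
  countable A -> countable B -> countable (A `|` B).
Proof.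
move=> cA cB.
have -> : A `|` B = \bigcup_(b in [set: bool]) (if b then A else B).
  apply/seteqP; split=> [x [?|?]|x [[] _ ?]];
    by [exists true | exists false | left | right].
by apply: bigcup_countable => // -[].
Qed.

(** Lists of rationals form a countable type; missing entries count as 0. *)
Definition qspan n (v : nat -> R) : set R :=
  range (fun q : seq rat => \sum_(i < n) ratr q`_i * v i).

Lemma countable_qspan n v : countable (qspan n v).
Proof. exact: sub_countable (card_image_le _ _) (countableP _). Qed.

(** An uncountable set minus a countable one is nonempty, so values can be picked one after another.
    [D] serves the diagonal argument of [uncountable_row]. *)
Lemma independent_choice (S : nat -> set R) (D : set R) :
  (forall n, ~ countable (S n)) -> countable D ->
  exists v : nat -> R, v 0 = 1 /\
    forall n, [/\ S n (v n.+1), ~ D (v n.+1) & ~ qspan n.+1 v (v n.+1)].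
Proof.
move=> hS cD.
have /choice[f hf] (sn : seq R * nat) : exists x, [/\ S sn.2 x, ~ D x &
    ~ qspan (size sn.1) (nth 0 sn.1) x].
  have [//|no] := pselect (exists x, [/\ S sn.2 x, ~ D x &
    ~ qspan (size sn.1) (nth 0 sn.1) x]).
  case: (hS sn.2); apply: sub_countable (countableU cD
    (countable_qspan (size sn.1) (nth 0 sn.1))).
  apply: subset_card_le => x Sx; apply: contrapT => /not_orP[? ?].
  by apply: no; exists x.
pose fix g n := if n is m.+1 then rcons (g m) (f (g m, m)) else [:: 1 : R].
pose v n := last 0 (g n).
have gE n : g n = mkseq v n.+1.
  by elim: n => [//|n IH]; rewrite mkseqS -IH /v /= last_rcons.
exists v; split => // n; have := hf (g n, n).
rewrite /= -[f _]/(last 0 [:: f (g n, n)]).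
have -> : last 0 [:: f (g n, n)] = v n.+1 by rewrite /v /= last_rcons.
rewrite gE size_mkseq => -[? ? h]; split => //.
move=> [q _ hq]; apply: h; exists q => //; rewrite -hq.
by apply: eq_bigr => i _; rewrite nth_mkseq.
Qed.

Lemma independent_of_avoid (v : nat -> R) : v 0 = 1 ->
  (forall n, ~ qspan n.+1 v (v n.+1)) ->
  forall n (c : nat -> rat), \sum_(i < n) ratr (c i) * v i = 0 ->
  forall i, (i < n)%N -> c i = 0.
Proof.
move=> v0 hv; elim => // n IH c; rewrite big_ord_recr /= => e.
have cn : c n = 0.
  case: n e {IH} => [|n].
    rewrite big_ord0 add0r v0 mulr1 => /eqP.
    by rewrite fmorph_eq0 => /eqP.
  move=> e; apply/eqP; apply/negP => /negP cn; apply: (hv n).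
  exists (mkseq (fun i => - c i / c n.+1) n.+1) => //.
  have cn' : ratr (c n.+1) != 0 :> R by rewrite fmorph_eq0.
  apply: (mulfI cn'); move/eqP: e; rewrite addrC addr_eq0 => /eqP ->.
  rewrite mulr_sumr -sumrN; apply: eq_bigr => i _; rewrite nth_mkseq//.
  by rewrite fmorph_div rmorphN /=; field.
move=> i; rewrite ltnS leq_eqVlt => /predU1P[->//|]; apply: IH.
by move: e; rewrite cn rmorph0 mul0r addr0.
Qed.

Lemma Q_lin_indep_row k (v : nat -> R) : v 0 = 1 ->
  (forall n, ~ qspan n.+1 v (v n.+1)) ->
  Q_lin_indep (row_mx (const_mx 1 : 'rV[R]_1) (\row_(j < k) v j.+1)).
Proof.
move=> v0 hv q e i.
have E (l : 'I_(1 + k)) :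
    row_mx (const_mx 1 : 'rV[R]_1) (\row_(j < k) v j.+1) ord0 l = v l.
  by rewrite !mxE; case: splitP => j ->; rewrite mxE// ord1 v0.
have := @independent_of_avoid v v0 hv (1 + k)%N (fun l => q (inord l)) _ i (ltn_ord i).
rewrite inord_val; apply; rewrite -[RHS]e; apply: eq_bigr => l _.
by rewrite inord_val E.
Qed.

Lemma uncountable_range (z : (nat -> bool) -> R) :
  injective z -> ~ countable (range z).
Proof.
move=> zI /countable_injP[f fI].
have fzI b b' : f (z b) = f (z b') -> b = b'.
  by move=> h; apply/zI/fI => //; rewrite inE; [exists b | exists b'].
(* Cantor's diagonal sequence; quantifying over all [c] with code n avoids inverting the coding. *)
pose b n := `[< forall c, f (z c) = n -> ~~ c n >].
have [bn|] := boolP (b (f (z b))).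
  by have /asboolP/(_ b erefl) := bn; rewrite bn.
by move=> /[dup] nb /asboolP; apply => c /fzI ->.
Qed.

End Independence.

(** Were [A] countable, so would be the set of its first coordinates; but a vector whose first
    coordinate avoids that set can be chosen inside [A]. *)
Lemma uncountable_row (R : realType) k (S : 'I_k.+1 -> set R)
    (A : set 'rV[R]_k.+1) :
  (forall j, ~ countable (S j)) ->
  (forall zeta : 'rV[R]_k.+1, (forall j, S j (zeta ord0 j)) ->
     Q_lin_indep (row_mx (const_mx 1 : 'rV[R]_1) zeta) -> A zeta) ->
  ~ countable A.
Proof.
move=> hS hA cA.
pose D := [set zeta ord0 ord0 | zeta in A].
have cD : countable D by exact: sub_countable (card_image_le _ _) cA.
have [v [v0 hv]] := @independent_choice R (S \o inord) D (fun n => hS (inord n)) cD.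
have [_ + _] := hv 0; apply; exists (\row_(j < k.+1) v j.+1); last by rewrite mxE.
apply: hA => [j|]; last by apply: Q_lin_indep_row => // n; have [] := hv n.
by rewrite mxE; have [/=+ _ _] := hv j; rewrite inord_val.
Qed.

(** * Vectors built on a cyclic schedule of private and common gaps *)

Theorem theorem3p3 (R : realType) (k : nat) (lam : 'I_k -> R) (w : R)
    (hk : (2 <= k)%N) (hw1 : 1 <= w) (hwlam : forall j : 'I_k, w <= lam j) :
  ~ countable [set zeta : 'rV[R]_k |
      [/\ Q_lin_indep (row_mx (const_mx 1 : 'rV[R]_1) zeta),
          forall j : 'I_k, lambda1 (zeta ord0 j) = (lam j)%:E &
          chi zeta = w%:E]].
Proof.
case: k lam hk hwlam => [//|k] lam hk hwlam.
have lam1 j : 1 <= lam j := le_trans hw1 (hwlam j).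
pose Lam := \sum_j lam j.
have lamL j : lam j <= Lam.
  rewrite /Lam (bigD1 j)//= lerDl sumr_ge0// => i _.
  exact: le_trans ler01 (lam1 i).
have L1 : 1 <= Lam := le_trans (lam1 ord0) (lamL ord0).
have wL : w <= Lam := le_trans (hwlam ord0) (lamL ord0).
(* After the case split there are k + 1 coordinates: residue j modulo k + 2 marks a stage private to
   coordinate j, residue k + 1 a common one. *)
pose c (j : 'I_k.+1) (i : nat) : R :=
  if (i %% k.+2 == k.+1)%N then w else if (i %% k.+2 == j)%N then lam j else 1.
have c1 j i : 1 <= c j i by rewrite /c; do 2 case: ifP => // _.
have clam j i : c j i <= lam j by rewrite /c; do 2 case: ifP => // _.
have cL j i : c j i <= Lam := le_trans (clam j i) (lamL j).
have /choice[phi hphi] j := exists_follows L1 (c1 j).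
have phi1 j Q : 1 <= phi j Q by have [] := hphi j.
have philam j Q : phi j Q <= lam j.
  by have [_ _ /(_ Q)[->|[i [_ _ ->]]]] := hphi j.
have /choice[z hz] j := exists_controlled (phi1 j).
have stage_arbitrary r (B : R) : (r < k.+2)%N ->
    exists i, B <= stage Lam i /\ (i %% k.+2 = r)%N.
  move=> rk; pose m := Num.truncn B; exists (m * k.+2 + r)%N; split.
    apply: le_trans (ltW (truncnS_gt B)) _.
    apply: le_trans (ltW (stage_gt L1 _)); rewrite ler_nat -/m; nia.
  by rewrite modnMDl modn_small.
have hit j b i : exists Q : nat, [/\ stage Lam i <= Q%:R,
    Q%:R < 4 * stage Lam i & dist_int (Q%:R * z j b) <= Q%:R `^ (- c j i)].
  have [_ zj] := hz j; have [_ /(_ _ (stage_gt1 L1 i))[]] := zj b.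
    by move=> Q Q1 Qi; apply: (follows_below L1 (cL j) (hphi j)).
  move=> Q [Q1 Q2 Q3]; exists Q; split => //.
  by have [_ /(_ i Q Q1 Q2) <- _] := hphi j.
apply: (@uncountable_row R k (fun j => range (z j))).
  by move=> j; apply: uncountable_range; have [] := hz j.
move=> zeta hzeta indep; split => //.
- move=> j; have [b _ <-] := hzeta j.
  apply/le_anti/andP; split.
    apply: lambda1_le => x x1.
    have xR1 : 1 <= x%:~R :> R by rewrite ler1z.
    have [_ /(_ b)[/(_ _ xR1) [Q [Q1 Qx xQ h]] _]] := hz j.
    apply: le_trans (h x _ _); last 2 first.
    + by rewrite gt_eqF// (lt_le_trans ltr01).
    + by rewrite ger0_norm// (le_trans ler01).
    rewrite lef_pV2 ?posrE ?mulr_gt0 ?powR_gt0//; try lra.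
    rewrite ler_pM2l//; apply: le_trans (ler_powR Q1 (philam j Q)) _.
    by rewrite ge0_ler_powR ?nnegrE// (le_trans ler01)//.
  apply: lambda1_ge => B.
  have jk : (j < k.+2)%N by rewrite ltnW// ltnS.
  have [i [Bi ij]] := stage_arbitrary j B jk.
  have [Q [Qi _ hQ]] := hit j b i; exists Q; first exact: le_trans Qi.
  by move: hQ; rewrite /c ij eqxx (ltn_eqF (ltn_ord j)).
- apply/le_anti/andP; split; last first.
    apply: chi_ge => // B.
    have [i [Bi ik]] := stage_arbitrary k.+1 B (ltnSn _).
    exists (stage Lam i) => // j; have [b _ <-] := hzeta j.
    by have := hit j b i; rewrite /c ik eqxx.
  apply: chi_le => X X1.
  (* Two coordinates with exponent > w at scale X would be in distinct stages,
     but a stage starts after the gap opened in an earlier one has closed. *)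
  have no_clash (j l : 'I_k.+1) i m (Q Q' : nat) : (i < m)%N ->
      1 <= Q%:R :> R -> Q%:R < 4 * stage Lam i -> X < 4 * Q%:R `^ c j i ->
      stage Lam m <= Q'%:R -> Q'%:R <= X -> False.
    move=> im Q1 Qi XQ mQ' Q'X.
    have := stage_powR L1 Q1 Qi (cL j i); have := stage_le L1 im.
    by lra.
  have [j [b bj [Q [Q1 QX XQ h] Qw]]] : exists j, exists2 b, z j b = zeta ord0 j &
      exists2 Q : nat, [/\ 1 <= Q%:R :> R, Q%:R <= X, X < 4 * Q%:R `^ phi j Q &
        forall x : int, x != 0 -> `|x|%:~R <= X ->
          (8 * Q%:R `^ phi j Q)^-1 <= dist_int (x%:~R * z j b)] &
      phi j Q <= w.
    have data j : exists2 b, z j b = zeta ord0 j & exists Q : nat,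
        [/\ 1 <= Q%:R :> R, Q%:R <= X, X < 4 * Q%:R `^ phi j Q &
        forall x : int, x != 0 -> `|x|%:~R <= X ->
          (8 * Q%:R `^ phi j Q)^-1 <= dist_int (x%:~R * z j b)].
      have [b _ bj] := hzeta j; exists b => //.
      by have [_ /(_ b)[/(_ _ X1)]] := hz j.
    (* Two coordinates suffice. An exponent above w occurs only in a private stage; distinct stages
       clash, and one shared stage would have residues 0 and 1 at once. *)
    pose j0 : 'I_k.+1 := ord0; pose j1 : 'I_k.+1 := inord 1.
    have j1E : j1 = 1%N :> nat by rewrite /j1 inordK.
    have [b0 bj0 [Q0 HQ0]] := data j0; have [b1 bj1 [Q1 HQ1]] := data j1.
    have [?|w0] := leP (phi j0 Q0) w; first by exists j0, b0 => //; exists Q0.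
    have [?|w1] := leP (phi j1 Q1) w; first by exists j1, b1 => //; exists Q1.
    have big j Q : w < phi j Q -> exists i, [/\ stage Lam i <= Q%:R,
        Q%:R < 4 * stage Lam i, phi j Q = c j i & (i %% k.+2 = j)%N].
      have [_ _ /(_ Q)[->|[i [i1 i2 e]]]] := hphi j; first by rewrite ltNge hw1.
      rewrite e => wc; exists i; split => //; move: wc; rewrite /c.
      case: ifP => _; first by rewrite ltxx.
      by case: ifP => [/eqP//|_]; rewrite ltNge hw1.
    have [i0 [a0 d0 e0 m0]] := big _ _ w0; have [i1 [a1 d1 e1 m1]] := big _ _ w1.
    case: HQ0 HQ1 => A0 B0 C0 _ [A1 B1 C1 _]; rewrite e0 in C0; rewrite e1 in C1.
    have [lt|lt|E] := ltngtP i0 i1.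
    + by case: (no_clash j0 j1 i0 i1 Q0 Q1).
    + by case: (no_clash j1 j0 i1 i0 Q1 Q0).
    + by move: m0 m1; rewrite E => ->; rewrite j1E.
  exists j => x x0 xX; rewrite -bj; apply: le_trans (h x x0 xX).
  rewrite lef_pV2 ?posrE ?mulr_gt0 ?powR_gt0//; try lra.
  rewrite ler_pM2l//; apply: le_trans (ler_powR Q1 Qw) _.
  by rewrite ge0_ler_powR ?nnegrE//; lra.
Qed.
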